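(* Let $p_1,p_2$ be distinct primes and $a\ge 1$ an integer, and let $n=p_1^{a}p_2$. If $n$ is a strong alpha number of order $(1,1)$, then $n$ is a perfect number, i.e. $\sigma(n)=2n$.
   Context: For a positive integer $n$, $\sigma(n)=\sum_{d\mid n} d$ and $\omega(n)$ is the number of distinct prime divisors of $n$. A positive integer $n$ is a strong alpha number of order $(1,1)$ if there exist coprime positive integers $\alpha_1,\alpha_2$ with $\sigma(n)=\frac{\alpha_1}{\alpha_2}n$ and $2\le \max(\alpha_1,\alpha_2)\le \omega(n)$. *)

(* Defs.v *)
From mathcomp Require Import all_boot all_order all_algebra.

Set Implicit Arguments.
Unset Strict Implicit.
Unset Printing Implicit Defensive.

Definition sigma (n : nat) : nat := \sum_(d <- divisors n) d.

Definition omega (n : nat) : nat := size (primes n).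

(* [sigma 0 = 0] because [divisors 0] is empty, hence the guards [0 < n]. *)
Definition perfect (n : nat) : Prop := 0 < n /\ sigma n = 2 * n.

Definition strong_alpha11 (n : nat) : Prop :=
  0 < n /\
  exists alpha1 alpha2 : nat,
    [/\ 0 < alpha1,
        0 < alpha2,
        coprime alpha1 alpha2,
        ((sigma n)%:R = alpha1%:R / alpha2%:R * n%:R :> rat)%R &
        2 <= maxn alpha1 alpha2 <= omega n].

(* Main.v *)
Require Import Defs.
From mathcomp Require Import all_boot all_order all_algebra.

(* Since [n] has at most two prime factors, the coprime pair [alpha1, alpha2]
   is [(2, 1)] or [(1, 2)], and the latter would give [sigma n = n / 2 < n]. *)

(** Clearing denominators gives [sigma n * c = b * n] in [nat], with [b, c <= 2] by [omega_pXM_le2].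
    The pair [(1, 2)] contradicts [leq_sigma]; the pair [(2, 1)] is perfection. *)

Lemma leq_sigma (n : nat) : n <= sigma n.
Proof.
case: n => [//|n].
have n_div : n.+1 \in divisors n.+1 by rewrite -dvdn_divisors.
by rewrite /sigma (bigD1_seq _ n_div (divisors_uniq _)) leq_addr.
Qed.

(** A prime divisor of the product is [p] or [q], so the duplicate-free list [primes] is contained
    in [[:: p; q]]. *)
Lemma omega_pXM_le2 (p q a : nat) :
  prime p -> prime q -> omega (p ^ a * q) <= 2.
Proof.
move=> p_pr q_pr; apply: (uniq_leq_size (s2 := [:: p; q]) (primes_uniq _)) => r.
rewrite mem_primes => /and3P[r_pr _].
rewrite Euclid_dvdM // Euclid_dvdX // !inE.
case/orP=> [/andP[r_p _]|r_q].
  by rewrite -(dvdn_prime2 r_pr p_pr) r_p.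
by rewrite -(dvdn_prime2 r_pr q_pr) r_q orbT.
Qed.

Theorem theorem3p5 (p1 p2 a n : nat)
  (p1_prime : prime p1) (p2_prime : prime p2) (p1_neq_p2 : p1 <> p2)
  (a_ge1 : 1 <= a) (n_def : n = p1 ^ a * p2) :
  strong_alpha11 n -> perfect n.
Proof.
move=> [n_gt0 [b [c [b_gt0 c_gt0 cop_bc sigma_eq /andP[bc_ge2 bc_le]]]]].
split=> //.
have sigmaE : sigma n * c = b * n.
  apply/eqP; rewrite -(Num.Theory.eqr_nat rat) !GRing.natrM sigma_eq.
  by rewrite GRing.mulrAC GRing.divfK // Num.Theory.pnatr_eq0 -lt0n.
have := omega_pXM_le2 p1 p2 a p1_prime p2_prime; rewrite -n_def.
move=> /(leq_trans bc_le); rewrite geq_max => /andP[b_le2 c_le2].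
(* [(1, 1)] fails [2 <= maxn b c] and [(2, 2)] is not coprime; [(1, 2)] and [(2, 1)] survive, in
   this order. *)
case: b c b_gt0 c_gt0 cop_bc bc_ge2 b_le2 c_le2 sigmaE {sigma_eq bc_le}
  => [|[|[|b]]] [|[|[|c]]] // _ _ _ _ _ _ sigmaE.
  have := leq_sigma n; rewrite -(leq_pmul2r (isT : 0 < 2)) sigmaE mul1n.
  by rewrite leqNgt ltn_Pmulr.
by rewrite -sigmaE muln1.
Qed.
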